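(* Let $G$ be a plane graph in which every $3$-face is adjacent to at most one $3$-face, and suppose $\delta(G)\geq 4$. Then $G$ contains at least one of the following: (H1) an edge both of whose endpoints have degree $4$; (H2) a triangle with one vertex of degree $4$ and the other two vertices of degree $5$; (H3) a triangle whose three vertices have degrees $4$, $5$ and $6$, such that the vertex of degree $6$ has a neighbor of degree $4$ that is not a vertex of the triangle. (All degrees are degrees in $G$.)
   Context: All graphs are finite and simple; $\delta(G)$ is the minimum degree; a triangle is a $3$-cycle. In a plane graph, a $k$-face is a face of length $k$ (length = number of edges on its boundary walk, a cut edge counted twice); two faces are adjacent if they share an edge. *)

(* Defs.v *)
From HB Require Import structures.
From mathcomp Require Import all_boot all_fingroup.

Set Implicit Arguments.
Unset Strict Implicit.
Unset Printing Implicit Defensive.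

Record sgraph := SGraph {
  vertex :> finType;
  adj : rel vertex;
  adj_sym : symmetric adj;
  adj_irrefl : irreflexive adj }.

Definition deg (G : sgraph) (v : G) : nat := #|[set w | adj v w]|.

(* Every degree is smaller than #|G|, so the starting value of the minimum     *)
(* only matters for the graph without vertices, whose minimum degree is then 0. *)
Definition mindeg (G : sgraph) : nat := \big[minn/#|G|]_(v : G) deg v.

Definition edges (G : sgraph) : {set {set G}} :=
  [set [set p.1; p.2] | p : G * G & adj p.1 p.2].

Definition ncomp (G : sgraph) : nat := n_comp (@adj G) G.

Definition triangle (G : sgraph) (x y z : G) : bool :=
  [&& adj x y, adj y z & adj z x].

Definition dart (G : sgraph) : finType := {p : G * G | adj p.1 p.2}.

Definition tail (G : sgraph) (d : dart G) : G := (val d).1.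

Lemma dart_rev_subproof (G : sgraph) (d : dart G) : adj (val d).2 (val d).1.
Proof. by rewrite adj_sym (valP d). Qed.

Definition dart_rev (G : sgraph) (d : dart G) : dart G :=
  Sub ((val d).2, (val d).1) (dart_rev_subproof d).

Lemma dart_revK (G : sgraph) : involutive (@dart_rev G).
Proof. by move=> d; apply: val_inj => /=; case: (val d). Qed.

Definition rev_perm (G : sgraph) : {perm dart G} := perm (inv_inj (@dart_revK G)).

Definition isolated (G : sgraph) : finType := {v : G | deg v == 0}.

(* If r sends a dart to the next one in clockwise order around its tail, then  *)
(* next_dart r follows a boundary walk with the face on its left.              *)
Definition next_dart (G : sgraph) (r : {perm dart G}) : {perm dart G} :=
  (rev_perm G * r)%g.

(* The boundary walks of the connected components, each component being drawn  *)
(* alone; an isolated vertex has one boundary walk, of length 0.               *)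
Definition nwalks (G : sgraph) (r : {perm dart G}) : nat :=
  #|porbits (next_dart r)| + #|isolated G|.

Definition incident (G : sgraph) (F : finType) (df : dart G -> F)
    (vf : isolated G -> F) (v : G) (f : F) : bool :=
  [exists d, (tail d == v) && (df d == f)]
  || [exists w, (val w == v) && (vf w == f)].

Definition linked (G : sgraph) (F : finType) (df : dart G -> F)
    (vf : isolated G -> F) : rel (G + F) :=
  fun a b => match a, b with
  | inl u, inl v => adj u v
  | inl v, inr f | inr f, inl v => incident df vf v f
  | inr _, inr _ => false
  end.

(* A plane graph, not necessarily connected, given by the combinatorial data of *)
(* its drawing: the cyclic order of the darts around each vertex, the faces,    *)
(* the face on the left of each dart, and the face containing each isolated     *)
(* vertex.                                                                      *)
(* - rot_orbit: around each vertex the darts form a single cycle.               *)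
(* - euler: every component is drawn with genus 0 (as no component can have     *)
(*   negative genus, the Euler formulas of the components may be added up).     *)
(* - face_connected, face_tree: the multigraph whose nodes are the components   *)
(*   and the faces, and whose edges are the boundary walks, each joining its    *)
(*   component to the face it bounds, is a tree; this says how the components   *)
(*   lie in the faces of each other. For a connected graph with an edge, it     *)
(*   makes the faces correspond to the orbits of next_dart rot.                 *)
Record plane_graph := PlaneGraph {
  pgraph :> sgraph;
  rot : {perm dart pgraph};
  face : finType;
  dface : dart pgraph -> face;
  vface : isolated pgraph -> face;
  rot_orbit : forall d d' : dart pgraph,
    (d' \in porbit rot d) = (tail d' == tail d);
  dface_walk : forall d : dart pgraph, dface (next_dart rot d) = dface d;
  euler : #|pgraph| + nwalks rot = #|edges pgraph| + 2 * ncomp pgraph;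
  face_connected : forall a b : pgraph + face, connect (linked dface vface) a b;
  face_tree : (nwalks rot).+1 = ncomp pgraph + #|face| }.

(* Each dart is one side of an edge, so an edge with the same face on both     *)
(* sides (a cut edge) is counted twice.                                        *)
Definition face_length (G : plane_graph) (f : face G) : nat :=
  #|[set d : dart G | dface d == f]|.

Definition face_adj (G : plane_graph) (f g : face G) : bool :=
  (f != g) && [exists d : dart G, (dface d == f) && (dface (dart_rev d) == g)].

(* Main.v *)
Require Import Defs.
From mathcomp Require Import all_boot all_fingroup.
From mathcomp Require Import zify.

(** Discharging.  Give every vertex the charge [deg v - 4] and every face the
    charge [length - 4]; by Euler's formula the total is negative, and only the
    3-faces are negative.  No three consecutive faces around a vertex are
    3-faces, so a vertex of degree [n] lies on at most [2n/3] of them.  Each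
    vertex of degree 5 gives 1/3 to each of its 3-faces, and each vertex of
    degree at least 7 gives 2/3.  A vertex of degree 6 gives 1/2, unless it has
    exactly one neighbour of degree 4: then it gives 2/3 to the (at most two)
    3-faces through that neighbour and 1/3 to the others.  If none of the three
    configurations occurs, then every 3-face receives at least 1 and no vertex
    becomes negative. *)

Set Implicit Arguments.
Unset Strict Implicit.
Unset Printing Implicit Defensive.

Lemma bigminn_leq_seq (I : eqType) (s : seq I) (F : I -> nat) (n : nat) (i : I) :
  i \in s -> \big[minn/n]_(j <- s) F j <= F i.
Proof.
elim: s => [//|j s IHs]; rewrite inE big_cons => /orP[/eqP->|/IHs le_i].
  exact: geq_minl.
by apply: leq_trans le_i; apply: geq_minr.
Qed.

(** * Simple graphs: degrees, darts and edges *)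

Section SimpleGraph.

Variable G : sgraph.
Implicit Types (u v : G) (d : dart G).

Definition head d : G := (val d).2.

Lemma mindeg_leq v : mindeg G <= deg v.
Proof. by rewrite /mindeg; apply: bigminn_leq_seq; rewrite mem_index_enum. Qed.

Lemma mindeg_gt0_card : 0 < mindeg G -> 0 < #|G|.
Proof.
rewrite /mindeg; case: (posnP #|G|) => // G0.
by rewrite big_pred0 ?G0 // => v; have := card0_eq G0 v.
Qed.

Lemma tail_rev d : tail (dart_rev d) = head d. Proof. by []. Qed.

Lemma head_rev d : head (dart_rev d) = tail d. Proof. by []. Qed.

Lemma dart_adj d : adj (tail d) (head d). Proof. exact: (valP d). Qed.

Lemma dart_inj d d' : tail d = tail d' -> head d = head d' -> d = d'.
Proof.
rewrite /tail /head => eq1 eq2; apply: val_inj.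
by case: (val d) (val d') eq1 eq2 => [a b] [a' b'] /= -> ->.
Qed.

Lemma card_tail v : #|[set d : dart G | tail d == v]| = deg v.
Proof.
have inj : {in [set d : dart G | tail d == v] &, injective head}.
  move=> d d'; rewrite !inE => /eqP td /eqP td'.
  by apply: dart_inj; rewrite td td'.
rewrite -(card_in_imset inj) /deg; apply: eq_card => w; rewrite inE.
apply/imsetP/idP => [[d]|vw]; first by rewrite inE => /eqP<- ->; apply: dart_adj.
by exists (Sub (v, w) vw); rewrite ?inE.
Qed.

Definition dart_edge d : {set G} := [set tail d; head d].

Lemma dart_edge_eq d d' : dart_edge d = dart_edge d' -> d = d' \/ d = dart_rev d'.
Proof.
move=> eq_e; have ne : tail d != head d.
  by apply/eqP=> e; have := dart_adj d; rewrite e adj_irrefl.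
have : tail d \in dart_edge d' by rewrite -eq_e !inE eqxx.
have : head d \in dart_edge d' by rewrite -eq_e !inE eqxx orbT.
rewrite !inE => /orP[] /eqP eh /orP[] /eqP et; rewrite ?et ?eh ?eqxx // in ne.
  by right; apply: dart_inj; rewrite ?tail_rev ?head_rev.
by left; apply: dart_inj.
Qed.

(** Darts are grouped by their underlying edge; a group holds at most a dart and its reverse. *)
Lemma card_dart_leq : #|dart G| <= 2 * #|edges G|.
Proof.
have -> : #|dart G| = \sum_(d : dart G) 1 by rewrite sum1_card.
rewrite (partition_big dart_edge [in edges G]) => [|d _].
  rewrite mulnC -sum_nat_const; apply: leq_sum => e _; rewrite sum1dep_card.
  case: (set_0Vmem [set d | dart_edge d == e]) => [->|[d0]].
    by rewrite cards0.
  rewrite inE => /eqP ed0.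
  have sub : [set d | dart_edge d == e] \subset [set d0; dart_rev d0].
    apply/subsetP => d; rewrite !inE => /eqP ed.
    by case: (@dart_edge_eq d d0); rewrite ?ed ?ed0 // => ->; rewrite eqxx ?orbT.
  by apply: leq_trans (subset_leq_card sub) _; rewrite cards2; case: (_ != _).
by apply/imsetP; exists (val d); rewrite ?inE ?(valP d).
Qed.

Lemma triangle_sym (x y z : G) : triangle x y z = triangle x z y.
Proof.
rewrite /triangle (adj_sym x y) (adj_sym y z) (adj_sym z x).
by rewrite andbC -andbA andbCA.
Qed.

Definition four_nbrs v : {set G} := [set w | adj v w & deg w == 4].

End SimpleGraph.

(** * Rotations, boundary walks and face lengths *)

Section PlaneGraph.

Variable G : plane_graph.
Implicit Types (v : G) (d e : dart G) (f : face G).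

Local Notation r := (Defs.rot G).
Local Notation nxt := (next_dart (Defs.rot G)).

Lemma nextE d : nxt d = r (dart_rev d).
Proof. by rewrite permM permE. Qed.

Lemma tail_rot d : tail (r d) = tail d.
Proof. by apply/eqP; rewrite -rot_orbit -{1}[Defs.rot G]expg1 mem_porbit. Qed.

Lemma tail_next d : tail (nxt d) = head d.
Proof. by rewrite nextE tail_rot. Qed.

Lemma dface_rot d : dface (r d) = dface (dart_rev d).
Proof. by rewrite -(dface_walk (dart_rev d)) nextE dart_revK. Qed.

Lemma card_porbit_rot d : #|porbit r d| = deg (tail d).
Proof.
by rewrite -card_tail; apply: eq_card => d'; rewrite inE rot_orbit.
Qed.

(** Eliminating the number of boundary walks between [euler] and [face_tree] leaves Euler's formula
    for a possibly disconnected graph. *)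
Lemma euler_faces : #|G| + #|face G| = #|edges G| + (ncomp G).+1.
Proof. by have := euler G; have := face_tree G; lia. Qed.

Hypothesis mindeg_ge4 : 4 <= mindeg G.

Lemma deg_ge4 v : 4 <= deg v.
Proof. exact: leq_trans (mindeg_leq v). Qed.

Lemma rot_neq d : r d != d.
Proof.
(* The orbit of [d] has [deg (tail d)] elements, and its trajectory from [d] lists them without
   repetition. *)
have := uniq_traject_porbit r d; have := deg_ge4 (tail d).
rewrite -card_porbit_rot; case: #|_| => [|[|n]] //= _.
by rewrite inE negb_or eq_sym => /andP[/andP[]].
Qed.

Lemma rot2_neq d : r (r d) != d.
Proof.
have := uniq_traject_porbit r d; have := deg_ge4 (tail d).
rewrite -card_porbit_rot; case: #|_| => [|[|[|n]]] //= _.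
by rewrite !inE !negb_or eq_sym => /andP[/and3P[_ + _] _]; rewrite eq_sym.
Qed.

Lemma next_neq d : nxt d != d.
Proof.
apply/eqP => /(congr1 (@tail G)); rewrite tail_next => e.
by have := dart_adj d; rewrite e adj_irrefl.
Qed.

(** A walk closing after two darts would turn back along the same edge, so the rotation would fix
    [dart_rev d]. *)
Lemma next2_neq d : nxt (nxt d) != d.
Proof.
apply/eqP => e.
have /eqP : nxt d = dart_rev d.
  by apply: dart_inj; [rewrite tail_next | rewrite -tail_next e].
by rewrite nextE (negPf (rot_neq _)).
Qed.

Lemma walk_uniq d : uniq [:: d; nxt d; nxt (nxt d)].
Proof.
have neq e e' : e' != e -> e != e' by rewrite eq_sym.
by rewrite /= !inE negb_or !(neq _ _ (next_neq _)) (neq _ _ (next2_neq _)).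
Qed.

Lemma walk_subset d :
  [set:: [:: d; nxt d; nxt (nxt d)]] \subset [set d' | dface d' == dface d].
Proof.
by apply/subsetP => d'; rewrite !inE => /or3P[] /eqP->; rewrite ?dface_walk.
Qed.

(** A path in the linked graph from [f] to some vertex starts with an incidence; it comes from a
    dart, as no vertex is isolated. *)
Lemma face_dart f : exists d, dface d = f.
Proof.
have /card_gt0P[v _] := mindeg_gt0_card (leq_trans (isT : 0 < 4) mindeg_ge4).
have /connectP[[|[u|//] p]] := face_connected (inr f) (inl v); first by [].
case/andP => /orP[/existsP[d /andP[_ /eqP<-]] _ _|/existsP[w _]]; first by exists d.
by have := deg_ge4 (val w); rewrite (eqP (valP w)).
Qed.

Lemma face_length_ge3 f : 3 <= face_length f.
Proof.
have [d <-] := face_dart f; apply: leq_trans (subset_leq_card (walk_subset d)).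
by rewrite cardsE (card_uniqP (walk_uniq d)).
Qed.

(** * Boundary walks of 3-faces *)

Definition tri d : bool := face_length (dface d) == 3.

Lemma tri_next d : tri (nxt d) = tri d.
Proof. by rewrite /tri dface_walk. Qed.

Lemma tri_walk d :
  tri d -> [set d' | dface d' == dface d] = [set:: [:: d; nxt d; nxt (nxt d)]].
Proof.
move=> /eqP tri_d; apply/esym/eqP; rewrite eqEcard walk_subset /=.
by rewrite [X in X <= _]tri_d cardsE (card_uniqP (walk_uniq d)).
Qed.

Lemma tri_mem d d' :
  tri d -> dface d' = dface d -> d' \in [:: d; nxt d; nxt (nxt d)].
Proof. by move=> /tri_walk/setP/(_ d'); rewrite !inE => <- ->. Qed.

(** The fourth dart of the walk is again one of the three on the face; the other two choices would
    give [nxt] a 2-cycle or a fixed point. *)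
Lemma tri_next3 d : tri d -> nxt (nxt (nxt d)) = d.
Proof.
move=> tri_d; have := @tri_mem d (nxt (nxt (nxt d))) tri_d.
rewrite !dface_walk !inE => /(_ erefl) /or3P[] /eqP // /eqP.
  by rewrite (negPf (next2_neq _)).
by rewrite (negPf (next_neq _)).
Qed.

Lemma tri_head d : tri d -> head (nxt (nxt d)) = tail d.
Proof. by move=> tri_d; rewrite -tail_next tri_next3. Qed.

Lemma tri_triangle d : tri d -> triangle (tail d) (head d) (head (nxt d)).
Proof.
move=> tri_d; rewrite /triangle dart_adj -tail_next dart_adj /=.
by rewrite -(tri_head tri_d) -tail_next dart_adj.
Qed.

(** The three darts of a 3-face have distinct tails, so the face has a single corner at each of its
    vertices. *)
Lemma tri_inj d d' : tri d -> dface d' = dface d -> tail d' = tail d -> d' = d.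
Proof.
move=> tri_d /(tri_mem tri_d); rewrite !inE => /or3P[] /eqP // -> et.
  by have := dart_adj d; rewrite -et tail_next adj_irrefl.
by have := dart_adj (nxt (nxt d)); rewrite et tri_head // adj_irrefl.
Qed.

Lemma tri_sum d (F : dart G -> nat) :
  tri d -> \sum_(d' | dface d' == dface d) F d' = F d + F (nxt d) + F (nxt (nxt d)).
Proof.
move=> tri_d; rewrite -addnA -[F (nxt (nxt d))]addn0.
transitivity (\sum_(d' <- [:: d; nxt d; nxt (nxt d)]) F d'); last first.
  by rewrite !big_cons big_nil.
rewrite big_uniq ?walk_uniq //; apply: eq_bigl => d'.
by have /setP/(_ d') := tri_walk tri_d; rewrite !inE.
Qed.

(** * Counting 3-faces around a vertex *)

Lemma sum_tail_rot v (F : dart G -> nat) :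
  \sum_(d | tail d == v) F (r d) = \sum_(d | tail d == v) F d.
Proof.
rewrite [RHS](reindex_inj (@perm_inj _ r)) /=.
by apply: eq_bigl => d; rewrite tail_rot.
Qed.

Hypothesis tri_adj : forall f, face_length f = 3 ->
  #|[set g : face G | (face_length g == 3) && face_adj f g]| <= 1.

(** Otherwise the middle face would be adjacent to both outer ones. The three faces are distinct
    because their darts are distinct and share a tail. *)
Lemma three_tri d : ~~ [&& tri d, tri (r d) & tri (r (r d))].
Proof.
apply/and3P => -[tri0 tri1 tri2].
have ne01 : dface (r d) != dface d.
  apply/eqP => /(tri_inj tri0); rewrite tail_rot => /(_ erefl) e.
  by have := rot_neq d; rewrite e eqxx.
have ne12 : dface (r (r d)) != dface (r d).
  apply/eqP => /(tri_inj tri1); rewrite tail_rot => /(_ erefl) e.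
  by have := rot_neq (r d); rewrite e eqxx.
have ne02 : dface (r (r d)) != dface d.
  apply/eqP => /(tri_inj tri0); rewrite !tail_rot => /(_ erefl) e.
  by have := rot2_neq d; rewrite e eqxx.
have := tri_adj (eqP tri1); rewrite leqNgt => /negP; apply.
apply/card_gt1P; exists (dface (r (r d))), (dface d); split=> //; rewrite inE.
  rewrite (tri2 : _ == _) /face_adj eq_sym ne12 /=.
  by apply/existsP; exists (r d); rewrite -dface_rot !eqxx.
rewrite (tri0 : _ == _) /face_adj ne01 /=.
by apply/existsP; exists (dart_rev d); rewrite dart_revK dface_rot !eqxx.
Qed.

(** Each corner lies in three windows of three consecutive corners, and each of the [deg v] windows
    holds at most two 3-faces. *)
Lemma tri_count v : 3 * \sum_(d | tail d == v) tri d <= 2 * deg v.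
Proof.
have -> : 3 * \sum_(d | tail d == v) tri d =
    \sum_(d | tail d == v) (tri d + tri (r d) + tri (r (r d))).
  have sum_rot := sum_tail_rot v (fun d => tri d : nat).
  have sum_rot2 := sum_tail_rot v (fun d => tri (r d) : nat).
  by rewrite !big_split /= sum_rot2 sum_rot !mulSn mul0n addn0 addnA.
rewrite -card_tail mulnC -sum_nat_const.
rewrite [X in _ <= X](eq_bigl (fun d => tail d == v)) => [|d]; last by rewrite inE.
apply: leq_sum => d _; have := three_tri d.
by case: (tri d); case: (tri (r d)); case: (tri (r (r d))).
Qed.

(** * Discharging rules and the charge left at a vertex *)

Definition meets4 d : bool := (deg (head d) == 4) || (deg (head (nxt d)) == 4).

(* Six times the charge sent by [tail d] to the face on the left of [d]. *)
Definition charge d : nat :=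
  if ~~ tri d then 0 else
  if deg (tail d) <= 4 then 0 else
  if deg (tail d) == 5 then 2 else
  if 6 < deg (tail d) then 4 else
  if #|four_nbrs (tail d)| != 1 then 3 else
  if meets4 d then 4 else 2.

(* The corner at [d] lies between [r^-1 d] and [d], so a 3-face at [v] meeting the
   only neighbour [x] of degree 4 has its corner on one side of the edge [vx]. *)
Lemma meets4_count v :
  #|four_nbrs v| = 1 -> \sum_(d | tail d == v) (tri d && meets4 d) <= 2.
Proof.
move=> /eqP/cards1P[x nbrs].
have /setP/(_ x) := nbrs; rewrite !inE eqxx => /andP[vx _].
pose e : dart G := Sub (v, x) vx.
have sub : [set d | (tail d == v) && (tri d && meets4 d)] \subset [set e; r e].
  apply/subsetP => d; rewrite !inE => /and3P[/eqP tv tri_d].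
  have tri_e u : adj v u -> deg u == 4 -> u = x.
    by move=> vu u4; apply/eqP; rewrite -in_set1 -nbrs inE vu u4.
  case/orP => [/(tri_e _)|/(tri_e _)] hx.
    apply/orP; left; apply/eqP; apply: dart_inj => //; apply: hx.
    by rewrite -tv dart_adj.
  apply/orP; right; apply/eqP; rewrite -[LHS](tri_next3 tri_d) nextE; congr (r _).
  apply: dart_inj; first by rewrite tail_rev tri_head.
  rewrite head_rev tail_next; apply: hx.
  by rewrite -tv adj_sym; case/and3P: (tri_triangle tri_d).
have := subset_leq_card sub; rewrite cards2 -sum1dep_card big_mkcondr /=.
set S := \sum_(d | _) _ => leS; apply: leq_trans (_ : S <= 2).
  by apply: leq_sum => d _; case: (_ && _).
by apply: leq_trans leS _; case: (_ != _).
Qed.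

(** In sixths, [v] starts with [6 * deg v - 24]. Degree 7 relies on integrality: at most 14/3 means
    at most four 3-faces, costing 16 out of 18. *)
Lemma sum_charge v : \sum_(d | tail d == v) charge d + 24 <= 6 * deg v.
Proof.
have := tri_count v; have v4 := deg_ge4 v; set S := \sum_(d | _) charge d.
set T := \sum_(d | _) _ => leT.
have bound c : (forall d, tail d = v -> charge d <= c * tri d) -> S <= c * T.
  by move=> le_c; rewrite big_distrr /=; apply: leq_sum => d /eqP/le_c.
case: (ltngtP (deg v) 5) => [lt5|gt5|eq5].
- suff /bound : forall d, tail d = v -> charge d <= 0 * tri d by lia.
  by move=> d tv; rewrite /charge tv (lt5 : deg v <= 4); case: (tri d).
- case: (ltnP 6 (deg v)) => [gt6|le6].
    suff /bound : forall d, tail d = v -> charge d <= 4 * tri d by lia.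
    move=> d tv; rewrite /charge tv gt6; case: (tri d) => //=.
    by do 2 case: ifP => // _.
  have eq6 : deg v = 6 by lia.
  have [one|not1] := eqVneq #|four_nbrs v| 1; last first.
    suff /bound : forall d, tail d = v -> charge d <= 3 * tri d by lia.
    by move=> d tv; rewrite /charge tv eq6 not1 /=; case: (tri d).
  have := meets4_count one; set M := \sum_(d | _) _ => leM.
  (* Every 3-face gets 2, and those through the neighbour of degree 4 get 2 more; [T <= 4] and
     [M <= 2] give the available 12. *)
  suff : S = 2 * T + 2 * M by lia.
  rewrite !big_distrr -big_split /=; apply: eq_bigr => d /eqP tv.
  by rewrite /charge tv eq6 one /=; case: (tri d); case: (meets4 d).
- suff /bound : forall d, tail d = v -> charge d <= 2 * tri d by lia.
  by move=> d tv; rewrite /charge tv eq5; case: (tri d).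
Qed.

Lemma charge_ge2 d : tri d -> 4 < deg (tail d) -> 2 <= charge d.
Proof.
move=> tri_d gt4; rewrite /charge tri_d (leqNgt (deg _)) gt4 /=.
by do 4 case: ifP => // _.
Qed.

Lemma charge_ge3 d : tri d -> 5 < deg (tail d) -> meets4 d -> 3 <= charge d.
Proof.
move=> tri_d gt5 m4; rewrite /charge tri_d (leqNgt (deg _)) (ltnW gt5) m4 /= gtn_eqF //.
by do 2 case: ifP => // _.
Qed.

Lemma charge_eq4 d : tri d -> 6 < deg (tail d) -> charge d = 4.
Proof.
move=> tri_d gt6; rewrite /charge tri_d gt6 (leqNgt (deg _)) gtn_eqF ?(ltnW gt6) //=.
by rewrite (ltnW (ltnW gt6)).
Qed.

(** * Charge received by a 3-face when no configuration occurs *)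

Hypothesis no_H1 : forall u v : G, adj u v -> deg u = 4 -> deg v = 4 -> False.
Hypothesis no_H2 : forall x y z : G,
  triangle x y z -> deg x = 4 -> deg y = 5 -> deg z = 5 -> False.
Hypothesis no_H3 : forall x y z w : G,
  triangle x y z -> deg x = 4 -> deg y = 5 -> deg z = 6 ->
  adj z w -> deg w = 4 -> w \in [:: x; y; z].

(** This puts [z] under the exceptional rule for degree 6: a neighbour of degree 4 must lie on the
    triangle, where only [x] has that degree. *)
Lemma four_nbrs_H3 (x y z : G) :
  triangle x y z -> deg x = 4 -> deg y = 5 -> deg z = 6 -> #|four_nbrs z| = 1.
Proof.
move=> xyz x4 y5 z6; apply/eqP/cards1P; exists x; apply/setP => w; rewrite !inE.
apply/andP/eqP => [[zw /eqP w4]|->]; last by case/and3P: xyz => _ _ ->; rewrite x4.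
have := no_H3 xyz x4 y5 z6 zw w4; rewrite !inE => /or3P[] /eqP // e.
  by rewrite e y5 in w4.
by rewrite e z6 in w4.
Qed.

Lemma charge_456 d (x y : G) : tri d -> triangle x y (tail d) -> meets4 d ->
  deg x = 4 -> deg y = 5 -> 5 < deg (tail d) -> charge d = 4.
Proof.
move=> tri_d xyz m4 x4 y5 gt5; case: (ltnP 6 (deg (tail d))) => [|le6].
  exact: charge_eq4.
have eq6 : deg (tail d) = 6 by lia.
by rewrite /charge tri_d eq6 (four_nbrs_H3 xyz x4 y5 eq6) m4.
Qed.

(** Without (H1) both other vertices have degree at least 5, and without (H2) not both have degree
    5. They then send at least 3 + 3, or 2 + 4 when one has degree 5. *)
Lemma charge_at4 d :
  tri d -> deg (tail d) = 4 -> 6 <= charge (nxt d) + charge (nxt (nxt d)).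
Proof.
move=> tri_d x4; have tri1 : tri (nxt d) by rewrite tri_next.
have tri2 : tri (nxt (nxt d)) by rewrite !tri_next.
have xyz := tri_triangle tri_d; have xzy := xyz; rewrite triangle_sym in xzy.
have m1 : meets4 (nxt d) by rewrite /meets4 tri_head // x4 eqxx orbT.
have m2 : meets4 (nxt (nxt d)) by rewrite /meets4 tri_head // x4 eqxx.
have ty : tail (nxt d) = head d by rewrite tail_next.
have tz : tail (nxt (nxt d)) = head (nxt d) by rewrite tail_next.
have /and3P[xy yz zx] := xyz; rewrite adj_sym in zx.
have y5 : 4 < deg (head d).
  by rewrite ltn_neqAle deg_ge4 andbT; apply/eqP => /esym; apply: no_H1 x4.
have z5 : 4 < deg (head (nxt d)).
  by rewrite ltn_neqAle deg_ge4 andbT; apply/eqP => /esym; apply: no_H1 x4.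
have [|gty|eqy] := ltngtP (deg (head d)) 5; first by rewrite ltnNge y5.
  have [|gtz|eqz] := ltngtP (deg (head (nxt d))) 5; first by rewrite ltnNge z5.
    by apply: (@leq_add 3 3); apply: charge_ge3; rewrite ?ty ?tz.
  rewrite (@charge_456 (nxt d) (tail d) (head (nxt d))) ?ty //.
  by apply: (@leq_add 4 2) => //; apply: charge_ge2; rewrite ?tz.
have [|gtz|eqz] := ltngtP (deg (head (nxt d))) 5; first by rewrite ltnNge z5.
  rewrite (@charge_456 (nxt (nxt d)) (tail d) (head d)) ?tz //.
  by apply: (@leq_add 2 4) => //; apply: charge_ge2; rewrite ?ty.
by case: (no_H2 xyz x4 eqy eqz).
Qed.

Lemma charge_tri d : tri d ->
  6 <= charge d + charge (nxt d) + charge (nxt (nxt d)).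
Proof.
move=> tri_d; have tri1 : tri (nxt d) by rewrite tri_next.
have tri2 : tri (nxt (nxt d)) by rewrite !tri_next.
(* If some vertex has degree 4, the instance starting there suffices; otherwise each of the three
   vertices sends at least 2. *)
have := charge_at4 tri_d; have := charge_at4 tri1; have := charge_at4 tri2.
rewrite !tri_next3 //.
have := charge_ge2 tri_d; have := charge_ge2 tri1; have := charge_ge2 tri2.
have := deg_ge4 (tail d); have := deg_ge4 (tail (nxt d)).
have := deg_ge4 (tail (nxt (nxt d))).
lia.
Qed.

(** * Global count of charge and the contradiction *)

Lemma sum_charge_ge :
  6 * \sum_(f : face G) (face_length f == 3) <= \sum_d charge d.
Proof.
rewrite (partition_big (@dface G) predT) //= big_distrr /=.
apply: leq_sum => f _; have [d <-] := face_dart f.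
case: (boolP (_ == 3)) => [tri_d|_] //.
by rewrite tri_sum // muln1 charge_tri.
Qed.

Lemma sum_charge_le : \sum_d charge d + 24 * #|G| <= 6 * #|dart G|.
Proof.
have -> : #|dart G| = \sum_(v : G) deg v.
  have -> : #|dart G| = \sum_(d : dart G) 1 by rewrite sum1_card.
  rewrite (partition_big (@tail G) predT) //=.
  by apply: eq_bigr => v _; rewrite sum1dep_card card_tail.
rewrite (partition_big (@tail G) predT) //= mulnC -sum_nat_const -big_split /=.
by rewrite big_distrr /=; apply: leq_sum => v _; apply: sum_charge.
Qed.

Lemma sum_face_length :
  4 * #|face G| <= #|dart G| + \sum_(f : face G) (face_length f == 3).
Proof.
have -> : #|dart G| = \sum_(f : face G) face_length f.
  have -> : #|dart G| = \sum_(d : dart G) 1 by rewrite sum1_card.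
  rewrite (partition_big (@dface G) predT) //=.
  by apply: eq_bigr => f _; rewrite sum1dep_card.
rewrite mulnC -sum_nat_const -big_split /=; apply: leq_sum => f _.
by have := face_length_ge3 f; case: eqP => [->|]; lia.
Qed.

Lemma configurations_unavoidable : False.
Proof.
(* With n vertices, F faces, E edges, D darts and T 3-faces: T + 4n <= D and 4F <= D + T, so 4(n +
   F) <= 2D <= 4E, while Euler's formula gives n + F > E. *)
have := sum_charge_ge; have := sum_charge_le; have := sum_face_length.
have := card_dart_leq G; have := euler_faces; lia.
Qed.

End PlaneGraph.

Theorem theorem7 (G : plane_graph)
    (h3 : forall f : face G, face_length f = 3 ->
       #|[set g : face G | (face_length g == 3) && face_adj f g]| <= 1)
    (hdeg : 4 <= mindeg G) :
  (exists u v : G, [/\ adj u v, deg u = 4 & deg v = 4])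
  \/ (exists x y z : G, [/\ triangle x y z, deg x = 4, deg y = 5 & deg z = 5])
  \/ (exists x y z : G,
        [/\ triangle x y z, deg x = 4, deg y = 5 & deg z = 6]
        /\ exists w : G, [/\ adj z w, deg w = 4 & w \notin [:: x; y; z]]).
Proof.
(* Boolean quantifiers over the finite vertex type make the presence of each configuration
   decidable. *)
have [/'exists_existsP[u [v /and3P[uv /eqP u4 /eqP v4]]]|noH1] :=
  boolP [exists u : G, exists v : G, [&& adj u v, deg u == 4 & deg v == 4]].
  by left; exists u, v.
have [/existsP[x /'exists_existsP[y [z /and4P[xyz /eqP x4 /eqP y5 /eqP z5]]]]|noH2] :=
  boolP [exists x : G, exists y : G, exists z : G,
           [&& triangle x y z, deg x == 4, deg y == 5 & deg z == 5]].
  by right; left; exists x, y, z.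
have [/existsP[x /existsP[y /'exists_existsP[z [w]]]]|noH3] :=
  boolP [exists x : G, exists y : G, exists z : G, exists w : G,
           [&& triangle x y z, deg x == 4, deg y == 5 & deg z == 6]
           && [&& adj z w, deg w == 4 & w \notin [:: x; y; z]]].
  case/andP => /and4P[xyz /eqP x4 /eqP y5 /eqP z6] /and3P[zw /eqP w4 wn].
  by right; right; exists x, y, z; split=> //; exists w.
exfalso; apply: (configurations_unavoidable hdeg h3).
- move=> u v uv u4 v4; case/negP: noH1.
  by apply/existsP; exists u; apply/existsP; exists v; rewrite uv u4 v4.
- move=> x y z xyz x4 y5 z5; case/negP: noH2.
  apply/existsP; exists x; apply/existsP; exists y; apply/existsP; exists z.
  by rewrite xyz x4 y5 z5.
- move=> x y z w xyz x4 y5 z6 zw w4; apply: contraNT noH3 => wn.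
  apply/existsP; exists x; apply/existsP; exists y; apply/existsP; exists z.
  by apply/existsP; exists w; rewrite xyz x4 y5 z6 zw w4 wn.
Qed.
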